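(* Let $\mathbb{K}$ be an algebraically closed field of characteristic zero, let $n\ge 1$, and let $\preceq$ be a continuous positive order on $\mathbb{R}^n$. Then the set $\mathscr{S}^{\mathbb{K}}_\preceq$ of all series $\xi$ for which there exist $k\in\mathbb{Z}_{>0}$, $\gamma\in\mathbb{Z}^n$ and a rational cone $\sigma\subset(\mathbb{R}^n)_{\succeq 0}$ with $$\operatorname{Supp}(\xi)\subset(\gamma+\sigma)\cap\tfrac1k\mathbb{Z}^n$$ is an algebraically closed field (for the usual addition and multiplication of series).
   Context: A (polyhedral) cone in $\mathbb{R}^n$ is a set $\{\lambda_1u^{(1)}+\cdots+\lambda_ku^{(k)} : \lambda_i\in\mathbb{R}_{\ge0}\}$ for finitely many vectors $u^{(i)}\in\mathbb{R}^n$; it is rational if the generators can be chosen in $\mathbb{Z}^n$. A preorder on $\mathbb{R}^n$ is a relation $\preceq$ such that any two elements are comparable, which is transitive, and such that $u\preceq v$ implies $u+w\preceq v+w$. For $u_1,\dots,u_s\in\mathbb{R}^n$, the preorder $\leq_{(u_1,\dots,u_s)}$ is defined by $\alpha\leq_{(u_1,\dots,u_s)}\beta$ iff $(\alpha\cdot u_1,\dots,\alpha\cdot u_s)\leq_{\mathrm{lex}}(\beta\cdot u_1,\dots,\beta\cdot u_s)$, where $\cdot$ is the dot product and $\leq_{\mathrm{lex}}$ is the lexicographical order. Preorders of this form are called continuous; a continuous order is a continuous preorder that is an order (antisymmetric, hence total). $(\mathbb{R}^n)_{\succeq0}=\{\alpha\in\mathbb{R}^n : 0\preceq\alpha\}$.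 The preorder is positive if ${\mathbb{R}_{\ge0}}^n\subset(\mathbb{R}^n)_{\succeq0}$. A series here is a formal sum $\xi=\sum_{\alpha\in\mathbb{Q}^n}\xi_\alpha x^\alpha$ with $\xi_\alpha\in\mathbb{K}$, $x=(x_1,\dots,x_n)$, and $\operatorname{Supp}(\xi)=\{\alpha\in\mathbb{Q}^n : \xi_\alpha\ne0\}$. Addition is coefficientwise and multiplication is the Cauchy product. *)

(* Defs.v *)
From HB Require Import structures.
From mathcomp Require Import all_boot all_order all_algebra.
From mathcomp Require Import boolp classical_sets functions cardinality fsbigop.
From mathcomp Require Import reals.

Set Implicit Arguments.
Unset Strict Implicit.
Unset Printing Implicit Defensive.
Import Order.TTheory GRing.Theory Num.Theory.
Local Open Scope classical_set_scope.
Local Open Scope ring_scope.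

Section Cones.
Variables (R : realType) (n : nat).

Definition cone (k : nat) (u : 'I_k -> 'rV[R]_n) : set 'rV[R]_n :=
  [set x | exists l : 'I_k -> R,
     (forall i, 0 <= l i) /\ x = \sum_(i < k) l i *: u i].

Definition int_vec (z : 'rV[int]_n) : 'rV[R]_n := map_mx intr z.

Definition rat_vec (a : 'rV[rat]_n) : 'rV[R]_n := map_mx ratr a.

Definition rational_cone (sigma : set 'rV[R]_n) : Prop :=
  exists (k : nat) (u : 'I_k -> 'rV[int]_n),
    sigma = cone (fun i => int_vec (u i)).

(* (1/k) Z^n *)
Definition lattice (k : nat) : set 'rV[R]_n :=
  [set k%:R^-1 *: int_vec z | z in [set: 'rV[int]_n]].

End Cones.

Section Preorders.
Variables (R : realType) (n : nat).
Implicit Type le : rel 'rV[R]_n.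

Definition is_preorder le : Prop :=
  [/\ total le, transitive le & forall u v w, le u v -> le (u + w) (v + w)].

Definition dotprod (a b : 'rV[R]_n) : R := \sum_(i < n) a 0 i * b 0 i.

(* The comparison is that of the lexicographic order on [seqlexi R]; the two
   sequences have the same length. *)
Definition lex_preorder (us : seq 'rV[R]_n) : rel 'rV[R]_n := fun a b =>
  (([seq dotprod a u | u <- us] : seqlexi R)
    <= ([seq dotprod b u | u <- us] : seqlexi R))%O.

Lemma lex_preorderP us : is_preorder (lex_preorder us).
Proof.
split.
- by move=> a b; exact: le_total.
- by move=> b a c; exact: le_trans.
- move=> a b c; rewrite /lex_preorder.
  elim: us => [//|u us IH] /=; rewrite !lexi_cons.
  have dotD d : dotprod (d + c) u = dotprod d u + dotprod c u.
    by rewrite -big_split; apply: eq_bigr => i _; rewrite mxE mulrDl.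
  rewrite !dotD !lerD2r => /andP[-> /implyP H] /=.
  by apply/implyP => /H; exact: IH.
Qed.

Definition continuous_preorder le : Prop :=
  exists us : seq 'rV[R]_n, forall a b, le a b = lex_preorder us a b.

Definition continuous_order le : Prop :=
  continuous_preorder le /\ antisymmetric le.

Definition nonneg_part le : set 'rV[R]_n := [set a | le 0 a].

Definition positive_preorder le : Prop :=
  [set a : 'rV[R]_n | forall i, 0 <= a 0 i] `<=` nonneg_part le.

End Preorders.

Section Series.
Variables (K : fieldType) (n : nat).

(* The function a |-> xi a stands for the formal sum of the xi_a x^a. *)
Definition series : Type := 'rV[rat]_n -> K.

Definition Supp (xi : series) : set 'rV[rat]_n := [set a | xi a != 0].

Definition series_add (xi eta : series) : series := fun a => xi a + eta a.

(* The pairs of exponents contributing to the coefficient of x^a in xi * eta. *)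
Definition cauchy_pairs (xi eta : series) (a : 'rV[rat]_n) :
    set ('rV[rat]_n * 'rV[rat]_n) :=
  [set p | [/\ p.1 + p.2 = a, Supp xi p.1 & Supp eta p.2]].

Definition cauchy_defined (xi eta : series) : Prop :=
  forall a, finite_set (cauchy_pairs xi eta a).

(* Meaningful only under [cauchy_defined]: \sum_(_ \in _) is 0 when infinitely
   many terms are nonzero. *)
Definition series_mul (xi eta : series) : series := fun a =>
  \sum_(p \in cauchy_pairs xi eta a) xi p.1 * eta p.2.

End Series.

Definition cone_series (R : realType) (K : fieldType) (n : nat)
    (le : rel 'rV[R]_n) : set (series K n) :=
  [set xi | exists (k : nat) (gamma : 'rV[int]_n) (sigma : set 'rV[R]_n),
     [/\ (0 < k)%N, rational_cone sigma, sigma `<=` nonneg_part le &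
         @rat_vec R n @` Supp xi `<=`
           [set int_vec R gamma + x | x in sigma] `&` lattice k]].

Arguments cone_series {R} K {n} le.

(* The operations [add] and [mul] restrict to [A] and make it an algebraically
   closed field.  Zero, one, opposites and inverses are determined by [add] and
   [mul], so it is enough that the bijection [f] carries these two over. *)
Definition alg_closed_field_on (T : Type) (A : set T) (add mul : T -> T -> T) :
    Prop :=
  exists (F : closedFieldType) (f : F -> T),
    [/\ set_bij [set: F] A f,
        forall x y, f (x + y) = add (f x) (f y) &
        forall x y, f (x * y) = mul (f x) (f y)].

(* Main.v *)
From HB Require Import structures.
From mathcomp Require Import all_boot all_order all_algebra all_field.
From mathcomp Require Import boolp classical_sets functions cardinality fsbigop.
From mathcomp Require Import reals ring zify.
Require Import Defs.

(* By Gordan's lemma (round down the coefficients of a cone combination), a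
   series belongs to the set iff its support lies in g + <G>, the translate of
   the monoid generated by a finite set G of nonnegative elements of the
   divisible totally ordered group Q^n.  Dickson's lemma in <G> gives finitely
   many decompositions a = b + c in <G>, and a least exponent for every nonzero
   series.  The number of decompositions of a decreases strictly along proper
   summands, so equations for the coefficients can be solved by recursion on
   it; this yields inverses and Hensel's factorization lemma.

   A monic polynomial of degree at least 2 is then made free of its subleading
   term and rescaled by a monomial so that its coefficients have nonnegative
   exponents while its reduction over K is not a power of the variable.  In
   characteristic 0 that reduction cannot be a power (X - c)^d either, so it
   splits into coprime factors, which lift; induct on the degree. *)

Set Implicit Arguments.
Unset Strict Implicit.
Unset Printing Implicit Defensive.
Import Order.TTheory GRing.Theory Num.Theory.
Local Open Scope classical_set_scope.
Local Open Scope ring_scope.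

(** * Dickson's lemma in finitely generated monoids *)

Section NatSpan.
Variable V : zmodType.
Implicit Types (G H : seq V) (a b g : V).

(** The submonoid generated by [G], presented by adding one generator at a time so that proofs can
    go by induction on sums. *)
Inductive nspan G : V -> Prop :=
| nspan0 : nspan G 0
| nspanS g a : g \in G -> nspan G a -> nspan G (g + a).

Lemma nspanD G a b : nspan G a -> nspan G b -> nspan G (a + b).
Proof.
move=> Ga Gb; elim: Ga => [|g c gG _ IH]; first by rewrite add0r.
by rewrite -addrA; exact: nspanS.
Qed.

Lemma nspan_gen G g : g \in G -> nspan G g.
Proof. by move=> gG; rewrite -[g]addr0; apply: nspanS => //; exact: nspan0. Qed.

Lemma nspan_trans G H a :
  (forall g, g \in G -> nspan H g) -> nspan G a -> nspan H a.
Proof.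
move=> GH; elim=> [|g b gG _ IH]; first exact: nspan0.
by apply: nspanD => //; exact: GH.
Qed.

Lemma nspan_sub G H a : {subset G <= H} -> nspan G a -> nspan H a.
Proof. by move=> GH; apply: nspan_trans => g /GH; exact: nspan_gen. Qed.

Lemma nspanMn G a k : nspan G a -> nspan G (a *+ k).
Proof.
move=> Ga; elim: k => [|k IH]; first by rewrite mulr0n; exact: nspan0.
by rewrite mulrS; exact: nspanD.
Qed.

Lemma nspan_consP g G a :
  nspan (g :: G) a -> exists k b, nspan G b /\ a = g *+ k + b.
Proof.
elim=> [|h b hG _ [k [c [Gc ->]]]].
  by exists 0%N, 0; rewrite mulr0n addr0; split=> //; exact: nspan0.
move: hG; rewrite inE => /orP[/eqP->|hG].
  by exists k.+1, c; rewrite mulrS addrA.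
by exists k, (h + c); rewrite addrCA; split=> //; exact: nspanS.
Qed.

(** Induction on the generators. Forgetting the multiple of [g] leaves a set over [G], dominated by
    finitely many elements; these bound the multiplicities of [g] that need separate treatment, and
    each of the remaining finitely many slices is handled by the induction hypothesis. *)
Lemma dickson G (P : V -> Prop) : (forall a, P a -> nspan G a) ->
  exists s : seq V, (forall b, b \in s -> P b) /\
    (forall a, P a -> exists b, b \in s /\ nspan G (a - b)).
Proof.
elim: G P => [|g G IH] P PG.
  have P0 a : P a -> a = 0.
    by move=> /PG; case=> // h b; rewrite in_nil.
  have [Pz|nPz] := pselect (P 0).
    exists [:: 0]; split=> [b|a /P0->]; first by rewrite inE => /eqP->.
    by exists 0; rewrite subr0 mem_head; split=> //; exact: nspan0.
  by exists [::]; split=> // a Pa; case: nPz; rewrite -(P0 a Pa).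
have subG b : nspan G b -> nspan (g :: G) b.
  by apply: nspan_sub => h hG; rewrite inE hG orbT.
have slice k : exists s : seq V, (forall b, b \in s -> P b) /\
    (forall b, nspan G b -> P (g *+ k + b) ->
       exists c, c \in s /\ nspan (g :: G) (g *+ k + b - c)).
  have [|s [sP sG]] := IH (fun b => nspan G b /\ P (g *+ k + b)).
    by move=> a [].
  exists [seq g *+ k + b | b <- s]; split=> [b /mapP[c /sP[_ Pc] ->]//|b Gb Pb].
  have [c [cs Gc]] := sG b (conj Gb Pb).
  exists (g *+ k + c); rewrite map_f//; split=> //.
  by rewrite opprD addrACA subrr add0r; exact: subG.
have slices N : exists s : seq V, (forall b, b \in s -> P b) /\
    (forall k b, (k < N)%N -> nspan G b -> P (g *+ k + b) ->
       exists c, c \in s /\ nspan (g :: G) (g *+ k + b - c)).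
  elim: N => [|N [s [sP sG]]]; first by exists [::].
  have [t [tP tG]] := slice N.
  exists (s ++ t); split=> [b|k b].
    by rewrite mem_cat => /orP[/sP|/tP].
  rewrite ltnS leq_eqVlt => /orP[/eqP->|kN] Gb Pb.
    have [c [ct Gc]] := tG b Gb Pb.
    by exists c; rewrite mem_cat ct orbT.
  have [c [ct Gc]] := sG k b kN Gb Pb.
  by exists c; rewrite mem_cat ct.
have [|s [sP sG]] := IH (fun b => nspan G b /\ exists k, P (g *+ k + b)).
  by move=> a [].
(* Each element of [s] enters [P] with some multiple of [g]; [N] bounds the multiples chosen. *)
have [N sN] : exists N, forall b, b \in s ->
    exists2 k, (k <= N)%N & P (g *+ k + b).
  elim: (s) sP => [|b r IHr] sP; first by exists 0%N.
  have [N rN] := IHr (fun c cr => sP c (mem_behead (s := b :: r) cr)).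
  have [_ [k Pk]] := sP b (mem_head _ _).
  exists (maxn N k) => c; rewrite inE => /orP[/eqP->|/rN[l lN Pl]].
    by exists k => //; exact: leq_maxr.
  by exists l => //; exact: leq_trans (leq_maxl _ _).
have [t [tP tG]] := slices N.
have [f fP] : exists f : V -> nat, forall b, b \in s ->
    (f b <= N)%N /\ P (g *+ f b + b).
  have /choice[f fP] b : exists k, b \in s -> (k <= N)%N /\ P (g *+ k + b).
    have [bs|] := boolP (b \in s); last by exists 0%N.
    by have [k kN Pk] := sN b bs; exists k.
  by exists f.
exists (t ++ [seq g *+ f b + b | b <- s]); split=> [b|a Pa].
  by rewrite mem_cat => /orP[/tP|/mapP[c /fP[_ ?] ->]].
have [k [b [Gb ab]]] := nspan_consP (PG a Pa); rewrite {a}ab in Pa *.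
have [kN|Nk] := ltnP k N.
  have [c [ct Gc]] := tG k b kN Gb Pa.
  by exists c; rewrite mem_cat ct.
(* Here [k] is at least [N], hence at least [f c], so the excess of [g] is a natural multiple. *)
have [c [cs Gc]] := sG b (conj Gb (ex_intro _ k Pa)).
exists (g *+ f c + c); rewrite mem_cat (map_f (fun b => g *+ f b + b)) ?orbT//.
split=> //; rewrite opprD addrACA -mulrnBr; last first.
  by have [fN _] := fP c cs; exact: leq_trans Nk.
by apply: nspanD; [apply/nspanMn/nspan_gen/mem_head|exact: subG].
Qed.

End NatSpan.

(** * Totally ordered abelian groups and decompositions in positive monoids *)

Record ogroup := OGroup {
  og_sort :> zmodType;
  og_le : rel og_sort;
  og_total : total og_le;
  og_trans : transitive og_le;
  og_anti : antisymmetric og_le;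
  og_leD : forall a b c, og_le a b -> og_le (a + c) (b + c) }.

Local Notation "a <=o b" := (og_le a b) (at level 70, b at next level).
Local Notation positive G := (forall g, g \in G -> 0 <=o g).

Section OGroup.
Variable V : ogroup.
Implicit Types (G H : seq V) (a b c : V).

Lemma og_refl a : a <=o a.
Proof. by case/orP: (og_total a a). Qed.

Lemma og_leDr a b c : (a + c <=o b + c) = (a <=o b).
Proof.
apply/idP/idP; last exact: og_leD.
by move/(og_leD (- c)); rewrite -!addrA subrr !addr0.
Qed.

Lemma og_subr_ge0 a b : (0 <=o b - a) = (a <=o b).
Proof. by rewrite -(og_leDr _ _ a) add0r subrK. Qed.

Lemma og_addr_ge0 a b : 0 <=o a -> 0 <=o b -> 0 <=o a + b.
Proof.
move=> a0 b0; apply: og_trans b0 _.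
by rewrite -[X in X <=o _]add0r og_leDr.
Qed.

Lemma nspan_ge0 G a : positive G -> nspan G a -> 0 <=o a.
Proof.
move=> G0; elim=> [|g b /G0 g0 _]; [exact: og_refl|exact: og_addr_ge0].
Qed.

Lemma og_addr_eq0 a b : 0 <=o a -> 0 <=o b -> a + b = 0 -> a = 0.
Proof.
move=> a0 b0 ab; apply: og_anti; rewrite a0 andbT.
by rewrite -(og_leDr _ _ b) ab add0r.
Qed.

Lemma og_min (s : seq V) : s != [::] ->
  exists2 a, a \in s & forall b, b \in s -> a <=o b.
Proof.
elim: s => // a s IH _; have [->|/IH[b bs bm]] := eqVneq s [::].
  by exists a; rewrite ?mem_head// => b; rewrite inE => /eqP->; exact: og_refl.
case/orP: (og_total a b) => ab.
  exists a; rewrite ?mem_head// => c; rewrite inE => /orP[/eqP->|/bm].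
    exact: og_refl.
  exact: og_trans.
by exists b => [|c]; rewrite inE ?bs ?orbT// => /orP[/eqP->|/bm].
Qed.

(* Dickson's lemma applied to the pairs (b, a - b) in V x V. *)
Lemma decomp_finite G a : positive G ->
  exists s : seq V, uniq s /\
    forall b, (b \in s) <-> nspan G b /\ nspan G (a - b).
Proof.
move=> G0.
pose GG : seq (V * V)%type := [seq (g, 0) | g <- G] ++ [seq (0, g) | g <- G].
have GG0 p : nspan GG p -> 0 <=o p.1 /\ 0 <=o p.2.
  elim=> [|g q gG _ [q1 q2]]; first by split; exact: og_refl.
  suff [g1 g2] : 0 <=o g.1 /\ 0 <=o g.2 by split; exact: og_addr_ge0.
  by move: gG; rewrite mem_cat => /orP[] /mapP[h /G0 h0 ->] /=; split=> //;
    exact: og_refl.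
have GGp b c : nspan G b -> nspan G c -> nspan GG (b, c).
  move=> Gb Gc; have -> : (b, c) = (b, 0) + (0, c).
    by congr pair; rewrite /= ?addr0 ?add0r.
  apply: nspanD.
    elim: Gb => [|g d gG _ IH]; first exact: nspan0.
    have -> : (g + d, 0) = (g, 0) + (d, 0) :> V * V.
      by congr pair; rewrite /= ?addr0.
    by apply: nspanS => //; rewrite mem_cat map_f.
  elim: Gc => [|g d gG _ IH]; first exact: nspan0.
  have -> : (0, g + d) = (0, g) + (0, d) :> V * V.
    by congr pair; rewrite /= ?addr0.
  by apply: nspanS => //; rewrite mem_cat (map_f (fun x => (0, x))) ?orbT.
have [|s [sP sG]] := @dickson _ GG
    (fun p => [/\ nspan G p.1, nspan G p.2 & p.1 + p.2 = a]).
  by move=> [b c] [/= Gb Gc _]; exact: GGp.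
exists (undup [seq p.1 | p <- s]); split=> [|b]; first exact: undup_uniq.
rewrite mem_undup; split=> [/mapP[p /sP[p1 p2 pa] ->]|[Gb Gab]].
  by rewrite -pa addrC addKr.
have [|p [ps /GG0[/= p1 p2]]] := sG (b, a - b).
  by split=> //=; rewrite addrC subrK.
have [_ _ pa] := sP p ps.
(* The components of the difference of two pairs with sum [a] add up to 0; both being nonnegative,
   they vanish, so the dominating pair is the given one. *)
apply/mapP; exists p => //; apply/eqP; rewrite -subr_eq0; apply/eqP.
apply: og_addr_eq0 p1 p2 _.
by rewrite addrACA -opprD pa [b + _]addrC subrK subrr.
Qed.

(** The empty list is a default value for a [G] with a negative element. *)
Definition decomp G a : seq V :=
  if pselect (positive G) is left G0 then projT1 (cid (decomp_finite a G0))
  else [::].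

Lemma decomp_uniq G a : uniq (decomp G a).
Proof. by rewrite /decomp; case: pselect => // G0; case: cid => s []. Qed.

Lemma decompP G a : positive G ->
  forall b, (b \in decomp G a) <-> nspan G b /\ nspan G (a - b).
Proof. by rewrite /decomp => G0; case: pselect => // H; case: cid => s []. Qed.

(** Summands of [b] are summands of [a], but [a] is not a summand of [b], since [a - b] and [b - a]
    would both be nonnegative. This size is the measure for all recursions on exponents. *)
Lemma size_decomp G a b : positive G -> nspan G b -> nspan G (a - b) ->
  b != a -> (size (decomp G b) < size (decomp G a))%N.
Proof.
move=> G0 Gb Gab ba.
suff : (size (a :: decomp G b) <= size (decomp G a))%N by [].
have Ga : nspan G a by rewrite -[X in nspan _ X](subrK b); exact: nspanD.
apply: uniq_leq_size => [|c].
  rewrite /= decomp_uniq andbT; apply/negP => /(decompP _ G0)[_ Gba].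
  move/negP: ba; apply; rewrite -subr_eq0; apply/eqP.
  by apply: og_addr_eq0 (nspan_ge0 G0 Gba) (nspan_ge0 G0 Gab) _;
     rewrite addrA subrK subrr.
rewrite inE => /orP[/eqP->|/(decompP _ G0)[Gc Gbc]]; apply/(decompP _ G0).
  by rewrite subrr; split=> //; exact: nspan0.
by split=> //; rewrite -(subrK b a) -addrA; exact: nspanD.
Qed.

(** Iterate [F] from a constant function. As [F] looks only at proper summands, the value at [a] is
    stable once the number of iterations exceeds [size (decomp G a)]. *)
Lemma nspan_fixpoint (T : Type) (t0 : T) G (F : (V -> T) -> V -> T) :
  positive G ->
  (forall a z z', (forall b, nspan G b -> nspan G (a - b) -> b != a ->
     z b = z' b) -> F z a = F z' a) ->
  exists z, forall a, z a = F z a.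
Proof.
move=> G0 Floc; pose z k := iter k F (fun=> t0).
have zE k l a : (size (decomp G a) < k)%N -> (size (decomp G a) < l)%N ->
    z k a = z l a.
  elim: k l a => // k IH [|l] a //= ak al.
  apply: Floc => b Gb Gab ba; have lt := size_decomp G0 Gb Gab ba.
  by apply: IH; exact: leq_trans lt _.
exists (fun a => z (size (decomp G a)).+1 a) => a.
apply: Floc => b Gb Gab ba; apply: zE => //; exact: size_decomp.
Qed.

End OGroup.

(** * The ring of series with finitely generated supports *)

Section ConeSeries.
Variables (V : ogroup) (K : fieldType).
Implicit Types (G H : seq V) (a b c : V) (xi eta zeta : V -> K).

(** Spelled like [series_mul], so that the two agree by computation. *)
Definition conv xi eta a : K :=
  \sum_(p \in [set p : V * V |
              [/\ p.1 + p.2 = a, xi p.1 != 0 & eta p.2 != 0]])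
    xi p.1 * eta p.2.

(** The list may be larger than the set of contributing exponents, so several products can be
    computed over one common list. *)
Lemma convE (s : seq V) xi eta a : uniq s ->
  (forall b, xi b != 0 -> eta (a - b) != 0 -> b \in s) ->
  conv xi eta a = \sum_(b <- s) xi b * eta (a - b).
Proof.
move=> us sP; rewrite /conv (@fsbig_fwiden _ _ _ _ [seq (b, a - b) | b <- s]).
- by rewrite big_map.
- move=> [b c] /= [bca xb ec]; rewrite -bca.
  apply/mapP; exists b; last by rewrite [b + _]addrC addrK.
  by apply: sP => //; rewrite -bca addrC addKr.
- by rewrite map_inj_uniq// => b c [].
move=> p [/= /mapP[b bs ->] nP] /=; apply/eqP; rewrite mulf_eq0 -implyNb.
apply/implyP => xb; apply/negPn/negP => eb.
by apply: nP; split; rewrite //= subrKC.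
Qed.

Lemma convC xi eta a : (exists s : seq V, uniq s /\
    forall b, xi b != 0 -> eta (a - b) != 0 -> b \in s) ->
  conv xi eta a = conv eta xi a.
Proof.
move=> [s [us sP]]; rewrite (convE us)// (@convE [seq a - b | b <- s]).
- by rewrite big_map; apply: eq_bigr => b _; rewrite subKr mulrC.
- by rewrite map_inj_uniq// => b c /addrI/oppr_inj.
move=> b eb xb; apply/mapP; exists (a - b); rewrite ?subKr//.
by apply: sP; rewrite ?subKr.
Qed.

Lemma conv_neq0 xi eta a : conv xi eta a != 0 ->
  exists b, xi b != 0 /\ eta (a - b) != 0.
Proof.
apply: contra_neqP => nex; rewrite /conv fsbig1//= => -[b c] /= [bca xb ec].
by case: nex; exists b; rewrite -bca [b + _]addrC addrK.
Qed.

Definition bounded_by g G xi := forall a, xi a != 0 -> nspan G (a - g).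

Definition fg_supported xi := exists g G, positive G /\ bounded_by g G xi.

Lemma bounded_sub g G H xi : (forall h, h \in G -> nspan H h) ->
  bounded_by g G xi -> bounded_by g H xi.
Proof. by move=> GH xiG a /xiG; exact: nspan_trans. Qed.

Lemma positive_cat G H : positive G -> positive H -> positive (G ++ H).
Proof. by move=> G0 H0 g; rewrite mem_cat => /orP[/G0|/H0]. Qed.

Lemma bounded_catl g G H xi : bounded_by g G xi -> bounded_by g (G ++ H) xi.
Proof.
by apply: bounded_sub => h hG; apply: nspan_gen; rewrite mem_cat hG.
Qed.

Lemma bounded_catr g G H xi : bounded_by g G xi -> bounded_by g (H ++ G) xi.
Proof.
by apply: bounded_sub => h hG; apply: nspan_gen; rewrite mem_cat hG orbT.
Qed.

(** The exponents at which a factor with apex [g] can contribute to a product; for a second factor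
    with apex [h], the list is taken at [a - h]. *)
Definition cover g G a : seq V := [seq g + b | b <- decomp G (a - g)].

Lemma cover_uniq g G a : uniq (cover g G a).
Proof. by rewrite map_inj_uniq ?decomp_uniq// => b c /addrI. Qed.

Lemma coverP g G a b : positive G -> nspan G (b - g) -> nspan G (a - b) ->
  b \in cover g G a.
Proof.
move=> G0 bg ab; apply/mapP; exists (b - g); rewrite ?subrKC//.
apply/decompP => //; split=> //.
by rewrite opprB addrA subrK.
Qed.

Lemma cover_bounded g h G xi eta a : positive G ->
  bounded_by g G xi -> bounded_by h G eta ->
  forall b, xi b != 0 -> eta (a - b) != 0 -> b \in cover g G (a - h).
Proof.
move=> G0 xiG etaG b /xiG bg /etaG ab; apply: coverP => //.
by rewrite addrAC.
Qed.

Lemma bounded_conv g h G xi eta :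
  bounded_by g G xi -> bounded_by h G eta ->
  bounded_by (g + h) G (conv xi eta).
Proof.
move=> xiG etaG a /conv_neq0[b [/xiG bg /etaG ab]].
rewrite (_ : a - _ = (b - g) + (a - b - h)); first exact: nspanD.
by rewrite addrACA [b + _]addrC subrK opprD.
Qed.

Lemma fg_common xi eta : fg_supported xi -> fg_supported eta ->
  exists g h G, [/\ positive G, bounded_by g G xi & bounded_by h G eta].
Proof.
move=> [g [G [G0 xiG]]] [h [H [H0 etaH]]]; exists g, h, (G ++ H).
by split; [exact: positive_cat|exact: bounded_catl|exact: bounded_catr].
Qed.

Lemma fg_conv xi eta :
  fg_supported xi -> fg_supported eta -> fg_supported (conv xi eta).
Proof.
move=> xif /(fg_common xif)[g [h [G [G0 xiG etaG]]]].
by exists (g + h), G; split=> //; exact: bounded_conv.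
Qed.

(** The smaller apex [m] serves both series once the nonnegative differences [g - m] and [h - m]
    join the generators. *)
Lemma fg_add xi eta : fg_supported xi -> fg_supported eta ->
  fg_supported (fun a => xi a + eta a).
Proof.
move=> xif /(fg_common xif)[g [h [G [G0 xiG etaG]]]].
have [m [m_g m_h]] : exists m, m <=o g /\ m <=o h.
  by case/orP: (og_total g h) => gh; [exists g|exists h]; split=> //;
     exact: og_refl.
exists m, [:: g - m, h - m & G]; split.
  by move=> x; rewrite !inE => /or3P[/eqP->|/eqP->|/G0//]; rewrite og_subr_ge0.
move=> a; have [xa0|xa _] := eqVneq (xi a) 0.
  rewrite xa0 add0r => /etaG ah; rewrite -(subrKA h) [X in nspan _ X]addrC.
  apply: nspanS; first by rewrite !inE eqxx orbT.
  by apply: nspan_sub ah => x xG; rewrite !inE xG !orbT.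
rewrite -(subrKA g) [X in nspan _ X]addrC.
apply: nspanS; first by rewrite !inE eqxx.
by apply: nspan_sub (xiG a xa) => x xG; rewrite !inE xG !orbT.
Qed.

(** Both sides become the same double sum, over the exponents [b] of [xi] in [s] and [d] of [zeta]
    in [t]; the exponent of [eta] is then determined. *)
Lemma convA xi eta zeta :
  fg_supported xi -> fg_supported eta -> fg_supported zeta ->
  conv xi (conv eta zeta) = conv (conv xi eta) zeta.
Proof.
move=> [g1 [G1 [G10 xiG1]]] [g2 [G2 [G20 etaG2]]] [g3 [G3 [G30 zetaG3]]].
pose G := G1 ++ G2 ++ G3.
have G0 : positive G by do 2?apply: positive_cat.
have xiG : bounded_by g1 G xi by exact: bounded_catl.
have etaG : bounded_by g2 G eta by exact/bounded_catr/bounded_catl.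
have zetaG : bounded_by g3 G zeta by do 2?apply: bounded_catr.
have xeG := bounded_conv xiG etaG; have ezG := bounded_conv etaG zetaG.
apply/funext => a.
pose s := cover g1 G (a - (g2 + g3)); pose t := cover g3 G (a - (g1 + g2)).
have us : uniq s by exact: cover_uniq.
have ut : uniq t by exact: cover_uniq.
have tP d : zeta d != 0 -> conv xi eta (a - d) != 0 -> d \in t.
  exact: cover_bounded.
have sP b : xi b != 0 -> conv eta zeta (a - b) != 0 -> b \in s.
  exact: cover_bounded.
(* Swapping the factors lets the right side be summed over the exponent of [zeta]. *)
rewrite [RHS]convC; last first.
  exists (cover (g1 + g2) G (a - g3)).
  by split; [exact: cover_uniq|exact: cover_bounded].
rewrite (convE us)// (convE ut)//.
have -> : \sum_(b <- s) xi b * conv eta zeta (a - b) =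
          \sum_(b <- s) \sum_(d <- t) xi b * eta (a - b - d) * zeta d.
  (* The list [t] is known to contain the exponents of the inner product only when [b] is in the
     support of [xi]. *)
  apply: eq_bigr => b _; have [->|xb] := eqVneq (xi b) 0.
    by rewrite mul0r big1// => d _; rewrite !mul0r.
  rewrite convC; last first.
    exists (cover g2 G (a - b - g3)).
    by split; [exact: cover_uniq|exact: cover_bounded].
  rewrite (convE ut) => [|d /zetaG zd /etaG ed].
    by rewrite big_distrr; apply: eq_bigr => d _ /=; rewrite mulrAC mulrA.
  apply: coverP => //; have /xiG xb' := xb.
  rewrite (_ : _ - _ = (b - g1) + (a - b - d - g2)); first exact: nspanD.
  by rewrite [RHS]addrACA -opprD [b + _]addrC [_ + b]addrAC subrK [LHS]addrAC.
rewrite exchange_big; apply: eq_bigr => d _ /=.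
have [->|zd] := eqVneq (zeta d) 0.
  by rewrite mul0r big1// => b _; rewrite mulr0.
rewrite (convE us) => [|b /xiG xb /etaG eb].
  rewrite mulrC big_distrl; apply: eq_bigr => b _ /=.
  by rewrite -addrA [- b - d]addrC addrA.
apply: coverP => //; have /zetaG zd' := zd.
rewrite (_ : _ - _ = (d - g3) + (a - d - b - g2)); first exact: nspanD.
rewrite [RHS]addrACA -opprD [d + _]addrC [_ + d]addrAC subrK.
by rewrite [LHS]addrAC [g3 + _]addrC.
Qed.

Lemma convDl xi xi' eta :
  fg_supported xi -> fg_supported xi' -> fg_supported eta ->
  conv (fun a => xi a + xi' a) eta = fun a => conv xi eta a + conv xi' eta a.
Proof.
move=> [g1 [G1 [G10 xiG1]]] [g2 [G2 [G20 xiG2]]] [g3 [G3 [G30 etaG3]]].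
pose G := G1 ++ G2 ++ G3.
have G0 : positive G by do 2?apply: positive_cat.
have xiG : bounded_by g1 G xi by exact: bounded_catl.
have xiG' : bounded_by g2 G xi' by exact/bounded_catr/bounded_catl.
have etaG : bounded_by g3 G eta by do 2?apply: bounded_catr.
apply/funext => a.
pose s := undup (cover g1 G (a - g3) ++ cover g2 G (a - g3)).
have us : uniq s by exact: undup_uniq.
have sP b : xi b != 0 -> eta (a - b) != 0 -> b \in s.
  by rewrite mem_undup mem_cat => xb eb; rewrite (cover_bounded G0 xiG etaG).
have sP' b : xi' b != 0 -> eta (a - b) != 0 -> b \in s.
  by rewrite mem_undup mem_cat => xb eb;
     rewrite (cover_bounded G0 xiG' etaG)// orbT.
rewrite !(convE us)// => [|b xb].
  by rewrite -big_split; apply: eq_bigr => b _; rewrite mulrDl.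
have [xb0|/sP//] := eqVneq (xi b) 0.
by apply: sP'; move: xb; rewrite xb0 add0r.
Qed.

Definition monomial b (k : K) : V -> K := fun a => if a == b then k else 0.

Lemma fg_monomial b k : fg_supported (monomial b k).
Proof.
exists b, [::]; split=> // a; rewrite /monomial; case: (eqVneq a b) => [->|_].
  by rewrite subrr => _; exact: nspan0.
by rewrite eqxx.
Qed.

Lemma conv_monomial b k xi a : conv (monomial b k) xi a = k * xi (a - b).
Proof.
rewrite (@convE [:: b])// => [|c].
  by rewrite big_seq1 /monomial; case: eqP.
by rewrite /monomial inE; case: ifP => //; rewrite eqxx.
Qed.

(** Storing the support condition as a boolean makes equality of series equality of coefficients. *)
Record cser := CSer { cs_val :> V -> K; _ : `[< fg_supported cs_val >] }.

HB.instance Definition _ := [isSub for cs_val].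
HB.instance Definition _ := [Choice of cser by <:].

Lemma cs_fg (x : cser) : fg_supported x.
Proof. by case: x => xi /= /asboolP. Qed.

Lemma cs_inj (x y : cser) : (forall a, x a = y a) -> x = y.
Proof. by move=> xy; apply/val_inj/funext. Qed.

Definition mkcs xi (h : fg_supported xi) : cser := CSer (asboolT h).

Lemma fg_opp xi : fg_supported xi -> fg_supported (fun a => - xi a).
Proof.
move=> [g [G [G0 xiG]]]; exists g, G; split=> // a.
by rewrite oppr_eq0; exact: xiG.
Qed.

Definition cs_mono b k := mkcs (fg_monomial b k).
Definition cs_add (x y : cser) := mkcs (fg_add (cs_fg x) (cs_fg y)).
Definition cs_opp (x : cser) := mkcs (fg_opp (cs_fg x)).
Definition cs_mul (x y : cser) := mkcs (fg_conv (cs_fg x) (cs_fg y)).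

Lemma cs_addA : associative cs_add.
Proof. by move=> x y z; apply: cs_inj => a /=; rewrite addrA. Qed.

Lemma cs_addC : commutative cs_add.
Proof. by move=> x y; apply: cs_inj => a /=; rewrite addrC. Qed.

Lemma cs_add0 : left_id (cs_mono 0 0) cs_add.
Proof.
by move=> x; apply: cs_inj => a /=; rewrite /monomial; case: ifP; rewrite add0r.
Qed.

Lemma cs_addN : left_inverse (cs_mono 0 0) cs_opp cs_add.
Proof.
by move=> x; apply: cs_inj => a /=; rewrite /monomial addNr; case: ifP.
Qed.

HB.instance Definition _ :=
  GRing.isZmodule.Build cser cs_addA cs_addC cs_add0 cs_addN.

Lemma cs_mulA : associative cs_mul.
Proof. by move=> x y z; apply/val_inj/convA; exact: cs_fg. Qed.

Lemma cs_mulC : commutative cs_mul.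
Proof.
move=> x y; apply: cs_inj => a; apply: convC.
have [g [h [G [G0 xG yG]]]] := fg_common (cs_fg x) (cs_fg y).
by exists (cover g G (a - h)); split; [exact: cover_uniq|exact: cover_bounded].
Qed.

Lemma cs_mul1 : left_id (cs_mono 0 1) cs_mul.
Proof.
by move=> x; apply: cs_inj => a; rewrite /= conv_monomial mul1r subr0.
Qed.

Lemma cs_mulD : left_distributive cs_mul cs_add.
Proof. by move=> x y z; apply/val_inj/convDl; exact: cs_fg. Qed.

Lemma cs_one_neq0 : cs_mono 0 1 != 0.
Proof.
apply/eqP => /(congr1 (fun x : cser => x 0)) /=.
by rewrite /monomial eqxx => /eqP; rewrite oner_eq0.
Qed.

HB.instance Definition _ := GRing.Zmodule_isComNzRing.Build cser
  cs_mulA cs_mulC cs_mul1 cs_mulD cs_one_neq0.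

End ConeSeries.

(** * Leading exponents and inverses *)

Section ConeSeriesField.
Variables (V : ogroup) (K : fieldType).
Local Notation S := (cser V K).
Implicit Types (G H : seq V) (a b c : V) (x y : S).

Lemma cs0E a : (0 : S) a = 0.
Proof. by rewrite /= /monomial; case: ifP. Qed.

Lemma cs1E a : (1 : S) a = if a == 0 then 1 else 0.
Proof. by []. Qed.

(** Named so that it carries an additive structure and can be mapped over polynomials. *)
Definition cs_coef a x : K := x a.

Lemma cs_coef_is_zmod_morphism a : zmod_morphism (cs_coef a).
Proof. by []. Qed.

HB.instance Definition _ a :=
  GRing.isZmodMorphism.Build S K (cs_coef a) (cs_coef_is_zmod_morphism a).

Lemma bounded0P G x : bounded_by 0 G x <-> forall a, x a != 0 -> nspan G a.
Proof. by split=> xG a /xG; rewrite subr0. Qed.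

Lemma csME G x y a : positive G -> bounded_by 0 G x -> bounded_by 0 G y ->
  (x * y) a = \sum_(b <- decomp G a) x b * y (a - b).
Proof.
move=> G0 xG yG; rewrite /= (convE (decomp_uniq G a))// => b.
by move=> /xG; rewrite subr0 => bG /yG; rewrite subr0 => abG; apply/decompP.
Qed.

Lemma decomp0 G : positive G -> decomp G 0 = [:: 0].
Proof.
move=> G0; apply: perm_small_eq => //.
apply: uniq_perm => //; [exact: decomp_uniq|move=> b].
rewrite inE; apply/idP/eqP => [/(decompP _ G0)[b0]|->].
  rewrite sub0r => /(nspan_ge0 G0) nb0.
  by apply: og_addr_eq0 (nspan_ge0 G0 b0) nb0 _; rewrite subrr.
by apply/decompP => //; rewrite subrr; split; exact: nspan0.
Qed.

Lemma mem_decomp0 G a : positive G -> nspan G a -> 0 \in decomp G a.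
Proof.
move=> G0 Ga; apply/decompP; rewrite ?subr0//.
by split=> //; exact: nspan0.
Qed.

Lemma mem_decomp G a : positive G -> nspan G a -> a \in decomp G a.
Proof.
move=> G0 Ga; apply/decompP; rewrite ?subrr//.
by split=> //; exact: nspan0.
Qed.

Lemma decomp_nspan G a b : positive G -> b \in decomp G a -> nspan G a.
Proof.
move=> G0 /(decompP _ G0)[Gb Gab].
by rewrite -[X in nspan _ X](subrK b); exact: nspanD.
Qed.

(* Dickson's lemma bounds the support by finitely many of its elements, and the
   least of these is the leading exponent. *)
Lemma leading_exponent x : x != 0 ->
  exists v G, [/\ positive G, x v != 0 & bounded_by v G x].
Proof.
move=> x0; have [g [G [G0 xG]]] := cs_fg x.
have [|s [sP sG]] := @dickson _ G (fun b => x (g + b) != 0).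
  by move=> b /xG; rewrite [g + _]addrC addrK.
have [|m ms mle] := @og_min _ s.
  apply: contra x0 => /eqP s0; apply/eqP/cs_inj => a; rewrite cs0E.
  apply/eqP/negPn/negP => xa.
  have [|b []] := sG (a - g); first by rewrite subrKC.
  by rewrite s0.
(* An exponent of [x] lies above some [g + b] with [b] in [s]; the generator [b - m], nonnegative by
   minimality, leads down to the apex [g + m]. *)
exists (g + m), ([seq b - m | b <- s] ++ G); split.
- apply: positive_cat => // _ /mapP[b bs ->].
  by rewrite og_subr_ge0; exact: mle.
- exact: sP.
move=> a xa; have [|b [bs Gb]] := sG (a - g); first by rewrite subrKC.
rewrite opprD addrA -(subrKA b) [X in nspan _ X]addrC.
apply: nspanS; first by rewrite mem_cat (map_f (fun b => b - m)).
by apply: nspan_sub Gb => h hG; rewrite mem_cat hG orbT.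
Qed.

Lemma bounded_shift v G x k : bounded_by v G x ->
  bounded_by 0 G (cs_mono (- v) k * x).
Proof.
move=> xG; apply/bounded0P => a; rewrite /= conv_monomial mulf_eq0 negb_or.
by move=> /andP[_ /xG]; rewrite opprK addrK.
Qed.

(** Dividing by the leading term gives a series [e] with constant coefficient 1 and support in the
    monoid; the coefficients of its inverse are found by recursion. *)
Lemma cs_mulVx x : x != 0 -> exists y, y * x = 1.
Proof.
move=> /leading_exponent[v [G [G0 xv xG]]].
pose e := cs_mono (- v) (x v)^-1 * x.
have eG : bounded_by 0 G e by exact: bounded_shift.
have e0 : e 0 = 1 by rewrite /= conv_monomial opprK add0r mulVf.
suff [z ze] : exists z, z * e = 1.
  by exists (z * cs_mono (- v) (x v)^-1); rewrite -mulrA.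
move: e eG e0 => e eG e0.
(* The equation for the coefficient of [e * z = 1] at [a], solved for [z a] by means of
   [e 0 = 1]. *)
pose F (z : V -> K) a := (a == 0)%:R -
  \sum_(b <- decomp G a | b != 0) e b * z (a - b).
have [|z zE] := @nspan_fixpoint V K 0 G F G0.
  move=> a z z' zz'; rewrite /F; congr (_ - _).
  rewrite big_seq_cond [RHS]big_seq_cond.
  apply: eq_bigr => b /andP[/(decompP _ G0)[Gb Gab] b0]; congr (_ * _).
  apply: zz' => //; first by rewrite subKr.
  by rewrite -subr_eq0 addrC addrA addNr add0r oppr_eq0.
(* Outside the monoid [decomp G a] is empty, so the recursion yields 0. *)
have zG : bounded_by 0 G z.
  move=> a; rewrite subr0 zE /F; have [->|_] := eqVneq a 0.
    by move=> _; exact: nspan0.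
  case E : (decomp G a) => [|b s]; first by rewrite big_nil subrr eqxx.
  by move=> _; apply: (@decomp_nspan _ _ b) => //; rewrite E mem_head.
have zfg : fg_supported z by exists 0, G.
exists (mkcs zfg); rewrite mulrC.
apply: cs_inj => a; rewrite (csME _ G0)// cs1E.
have [ad|ad] := pselect (nspan G a); last first.
  rewrite big_seq big1 => [|b /(decomp_nspan G0)//].
  by case: eqP => // a0; case: ad; rewrite a0; exact: nspan0.
rewrite (bigD1_seq 0) ?decomp_uniq ?mem_decomp0//= e0 mul1r subr0 {1}zE /F.
by rewrite subrK; case: eqP.
Qed.

Definition cs_inv x : S :=
  if pselect (exists y, y * x = 1) is left H then projT1 (cid H) else 0.

Lemma cs_mulVf x : x != 0 -> cs_inv x * x = 1.
Proof.
by move=> /cs_mulVx H; rewrite /cs_inv; case: pselect => // h; case: cid.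
Qed.

Lemma cs_inv0 : cs_inv 0 = 0.
Proof.
rewrite /cs_inv; case: pselect => // h; exfalso; case: h => y /eqP.
by rewrite mulr0 eq_sym oner_eq0.
Qed.

HB.instance Definition _ := GRing.ComNzRing_isField.Build S cs_mulVf cs_inv0.

End ConeSeriesField.

(** * Hensel's lemma *)

Section Hensel.
Variables (V : ogroup) (K : fieldType).
Local Notation S := (cser V K).
Implicit Types (G : seq V) (a b c : V) (P Q : {poly S}).

(** A polynomial over series is read as a series with coefficients in [K[T]]; [pcoef 0] is then the
    reduction over [K]. *)
Definition pcoef a P : {poly K} := map_poly (cs_coef a) P.

Lemma coef_pcoef a P i : (pcoef a P)`_i = P`_i a.
Proof. by rewrite coef_map. Qed.

Lemma eq_pcoef P Q : (forall a, pcoef a P = pcoef a Q) -> P = Q.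
Proof.
by move=> PQ; apply/polyP => i; apply: cs_inj => a; rewrite -!coef_pcoef PQ.
Qed.

Definition coefs_in G P := forall i, bounded_by 0 G P`_i.

Lemma pcoefM G P Q a : positive G -> coefs_in G P -> coefs_in G Q ->
  pcoef a (P * Q) = \sum_(b <- decomp G a) pcoef b P * pcoef (a - b) Q.
Proof.
move=> G0 PG QG; apply/polyP => i.
rewrite coef_pcoef coefM coef_sum -/(cs_coef a _) raddf_sum.
transitivity (\sum_(j < i.+1) \sum_(b <- decomp G a)
                P`_j b * Q`_(i - j) (a - b)).
  by apply: eq_bigr => j _; exact: csME.
rewrite exchange_big; apply: eq_bigr => b _ /=.
by rewrite coefM; apply: eq_bigr => j _; rewrite !coef_pcoef.
Qed.

(** The uniform bound on the degrees is what turns a family of polynomials indexed by exponents into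
    one polynomial over series. *)
Lemma pcoef_surj G n (z : V -> {poly K}) : positive G ->
  (forall a, z a != 0 -> nspan G a) -> (forall a, size (z a) <= n)%N ->
  exists P, [/\ coefs_in G P, (size P <= n)%N & forall a, pcoef a P = z a].
Proof.
move=> G0 zG zn.
have zb i : bounded_by 0 G (fun a => (z a)`_i).
  move=> a zai; rewrite subr0; apply: zG.
  by apply: contraNneq zai => ->; rewrite coef0.
have zf i : fg_supported (fun a => (z a)`_i) by exists 0, G.
exists (\poly_(i < n) mkcs (zf i)); split=> [i||a]; last 2 first.
- exact: size_poly.
- apply/polyP => i; rewrite coef_pcoef coef_poly.
  case: ltnP => // ni; rewrite cs0E nth_default//.
  exact: leq_trans (zn a) ni.
rewrite coef_poly; case: ifP => _; first exact: zb.
by move=> a; rewrite cs0E eqxx.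
Qed.

Lemma size_polyM_ltn (p q : {poly K}) m n : (0 < m)%N ->
  (size p <= m)%N -> (size q < n)%N -> (size (p * q)%R < (m + n).-1)%N.
Proof.
move=> m0 pm qn; apply: leq_ltn_trans (size_polyMleq p q) _.
move: pm qn; move: (size p) (size q) => k l; lia.
Qed.

(** The difference [D] of the two sides is divisible by [g] and by [h], hence by their product,
    whose degree is larger than that of [D]. This solves the linear equation for one exponent in
    Hensel's lemma. *)
Lemma bezout_mod (u v g h r : {poly K}) : u * g + v * h = 1 ->
  g != 0 -> h != 0 -> (size r < size (g * h)%R)%N ->
  g * ((u * r) %% h) + ((v * r) %% g) * h = r.
Proof.
move=> uv g0 h0 rs.
pose x : {poly K} := (u * r) %% h; pose y : {poly K} := (v * r) %% g.
rewrite -/x -/y; apply/eqP; rewrite -subr_eq0; set D := (_ - _).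
have Dg : D = g * (x - u * r - (v * r) %/ g * h).
  have -> : D = g * x + y * h - (u * g + v * h) * r by rewrite uv mul1r.
  have /eqP := divp_eq (v * r) g; rewrite -/y addrC -subr_eq => /eqP <-; ring.
have Dh : D = h * (y - v * r - (u * r) %/ h * g).
  have -> : D = g * x + y * h - (u * g + v * h) * r by rewrite uv mul1r.
  have /eqP := divp_eq (u * r) h; rewrite -/x addrC -subr_eq => /eqP <-; ring.
have co : coprimep g h by apply/Bezout_eq1_coprimepP; exists (u, v).
have : g * h %| D.
  by rewrite Gauss_dvdp// {1}Dg Dh !dvdp_mulr.
apply: contraLR => D0; apply/negP => /(dvdp_leq D0).
rewrite leqNgt => /negP; apply.
have xs : (size x < size h)%N by rewrite ltn_modp.
have ys : (size y < size g)%N by rewrite ltn_modp.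
have gs : (0 < size g)%N by rewrite size_poly_gt0.
have hs : (0 < size h)%N by rewrite size_poly_gt0.
have ghs : size (g * h) = (size g + size h).-1 by exact: size_mul.
rewrite /D; apply: leq_ltn_trans (size_polyD _ _) _.
rewrite size_polyN gtn_max rs andbT.
apply: leq_ltn_trans (size_polyD _ _) _; rewrite gtn_max ghs.
by rewrite size_polyM_ltn//= mulrC addnC size_polyM_ltn.
Qed.

(** The leading coefficient 1 has no term of exponent other than 0. *)
Lemma size_pcoef_monic P a : P \is monic -> a != 0 ->
  (size (pcoef a P) < size P)%N.
Proof.
move=> Pm a0; have P0 : (0 < size P)%N by rewrite size_poly_gt0 monic_neq0.
rewrite -(prednK P0) ltnS; apply/leq_sizeP => j.
rewrite leq_eqVlt coef_pcoef => /orP[/eqP<-|].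
  by rewrite -/(lead_coef P) (monicP Pm) cs1E (negPf a0).
by rewrite prednK// => Pj; rewrite nth_default// cs0E.
Qed.

Lemma pcoef0_monic P : P \is monic ->
  size (pcoef 0 P) = size P /\ pcoef 0 P \is monic.
Proof.
move=> Pm; have e : lead_coef P 0 = 1 by rewrite (monicP Pm) cs1E eqxx.
have s : size (pcoef 0 P) = size P.
  by apply: size_map_poly_id0; rewrite /cs_coef e oner_eq0.
by split=> //; rewrite monicE lead_coefE s coef_pcoef -/(lead_coef P) e.
Qed.

(** Comparing coefficients at [a != 0] in [Q = P1 * P2] gives a linear equation in [K[T]] for the
    pair of coefficients at [a], whose right side involves only proper nonzero summands of [a]. It
    is solved by recursion with remainders modulo [g] and [h], which keeps the degrees below those
    of [g] and [h]. *)
Lemma hensel G Q (g h : {poly K}) : positive G -> coefs_in G Q ->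
  Q \is monic -> g \is monic -> h \is monic -> coprimep g h ->
  pcoef 0 Q = g * h ->
  exists P1 P2, [/\ P1 \is monic, size P1 = size g & Q = P1 * P2].
Proof.
move=> G0 QG Qm gm hm /Bezout_eq1_coprimepP[[u v] /= uv] Q0.
have g0 := monic_neq0 gm; have h0 := monic_neq0 hm.
have gs : (0 < size g)%N by rewrite size_poly_gt0.
have hs : (0 < size h)%N by rewrite size_poly_gt0.
have ghs : size (g * h) = (size g + size h).-1 by exact: size_mul.
(* What the two coefficients at [a] must account for: the terms with [b = 0] and [b = a] are left
   out, as they contain the unknowns. *)
pose rest (z : V -> {poly K} * {poly K}) a := pcoef a Q -
  \sum_(b <- decomp G a | (b != 0) && (b != a)) (z b).1 * (z (a - b)).2.
pose F z a := if a == 0 then (g, h)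
  else ((v * rest z a) %% g, (u * rest z a) %% h).
have sub_neq a b : b != 0 -> a - b != a.
  by move=> b0; rewrite -subr_eq0 addrAC subrr add0r oppr_eq0.
have [|z zE] := @nspan_fixpoint V _ (0, 0) G F G0.
  move=> a z z' zz'; rewrite /F /rest.
  pose rhs := \sum_(b <- decomp G a | (b != 0) && (b != a))
    (z' b).1 * (z' (a - b)).2.
  suff -> : \sum_(b <- decomp G a | (b != 0) && (b != a))
    (z b).1 * (z (a - b)).2 = rhs by [].
  rewrite big_seq_cond [RHS]big_seq_cond; apply: eq_bigr => b.
  move=> /andP[/(decompP _ G0)[Gb Gab] /andP[b0 ba]].
  by rewrite !zz'// ?subKr// sub_neq.
have z0 : z 0 = (g, h) by rewrite zE /F eqxx.
have z1s a : a != 0 -> (size (z a).1 < size g)%N.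
  by move=> a0; rewrite zE /F (negPf a0) /= ltn_modp.
have z2s a : a != 0 -> (size (z a).2 < size h)%N.
  by move=> a0; rewrite zE /F (negPf a0) /= ltn_modp.
(* Outside the monoid both the coefficient of [Q] and the sum vanish, so the remainders are 0. *)
have zG a : z a != 0 -> nspan G a.
  rewrite zE /F; have [->|a0] := eqVneq a 0; first by move=> _; exact: nspan0.
  apply: contra_neqP => nGa; rewrite /rest.
  have -> : pcoef a Q = 0.
    apply/polyP => i; rewrite coef0 coef_pcoef; apply/eqP/negPn/negP => Qa.
    by apply: nGa; move: (QG i a Qa); rewrite subr0.
  rewrite big_seq_cond big1 => [|b /andP[/(decomp_nspan G0)//]].
  by rewrite subrr !mulr0 !mod0p.
(* The degree of [rest] is below that of [g * h]: [Q] is monic with reduction [g * h], and the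
   products involve only lower-degree corrections. *)
have restE a : a != 0 -> g * (z a).2 + (z a).1 * h = rest z a.
  move=> a0; rewrite zE /F (negPf a0) /=; apply: bezout_mod => //.
  apply: leq_ltn_trans (size_polyD _ _) _.
  rewrite size_polyN gtn_max -Q0 (pcoef0_monic Qm).1 size_pcoef_monic//=.
  rewrite -(pcoef0_monic Qm).1 Q0 ghs.
  elim/big_ind: _ => [|p q ps qs|b /andP[b0 ba]].
  - by rewrite size_poly0 -ghs size_poly_gt0 mulf_neq0.
  - by apply: leq_ltn_trans (size_polyD _ _) _; rewrite gtn_max ps.
  apply: size_polyM_ltn => //; first exact/ltnW/z1s.
  by rewrite z2s// subr_eq0 eq_sym.
have [|a|P1 [P1G P1s P1E]] := @pcoef_surj G (size g) (fun a => (z a).1) G0.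
- by move=> a za; apply: zG; apply: contraNneq za => ->.
- by have [->|/z1s/ltnW//] := eqVneq a 0; rewrite z0.
have [|a|P2 [P2G _ P2E]] := @pcoef_surj G (size h) (fun a => (z a).2) G0.
- by move=> a za; apply: zG; apply: contraNneq za => ->.
- by have [->|/z2s/ltnW//] := eqVneq a 0; rewrite z0.
(* In the top degree only the exponent 0 contributes, through the monic [g]. *)
have P1l : P1`_(size g).-1 = 1.
  apply: cs_inj => a; rewrite -coef_pcoef P1E cs1E.
  have [->|/z1s za] := eqVneq a 0; first by rewrite z0 -(monicP gm).
  by rewrite nth_default// -ltnS prednK.
have P1s' : size P1 = size g.
  apply/eqP; rewrite eqn_leq P1s /= -(prednK gs) ltnNge.
  by apply/negP => /leq_sizeP/(_ _ (leqnn _))/eqP; rewrite P1l oner_eq0.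
exists P1, P2; split=> //; first by rewrite monicE lead_coefE P1s' P1l.
apply: eq_pcoef => a; rewrite (pcoefM _ G0 P1G P2G).
under eq_bigr do rewrite P1E P2E.
have [->|a0] := eqVneq a 0; first by rewrite decomp0// big_seq1 subrr z0 Q0.
have [Ga|nGa] := pselect (nspan G a); last first.
  rewrite big_seq_cond big1 => [|b /andP[/(decomp_nspan G0)//]].
  apply/polyP => i; rewrite coef0 coef_pcoef; apply/eqP/negPn/negP => Qa.
  by apply: nGa; move: (QG i a Qa); rewrite subr0.
(* The two terms split off are [g * (z a).2] and [(z a).1 * h], the left side of [restE]. *)
rewrite (bigD1_seq 0) ?decomp_uniq ?mem_decomp0//= z0 subr0.
rewrite -big_filter (bigD1_seq a) ?filter_uniq ?decomp_uniq//=; last first.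
  by rewrite mem_filter a0 mem_decomp.
rewrite big_filter_cond subrr z0 addrA restE// /rest.
by rewrite subrK.
Qed.

End Hensel.

(** * Algebraic closedness *)

(** Taylor's formula at [c], in terms of divided derivatives. *)
Lemma comp_poly_XaddC (R : comNzRingType) (p : {poly R}) c :
  p \Po ('X + c%:P) = \poly_(i < size p) p^`N(i).[c].
Proof.
rewrite /comp_poly addrC nderiv_taylor; last exact: commr_polyX.
rewrite size_map_polyC poly_def; apply: eq_bigr => i _.
by rewrite nderivn_map horner_map /= mul_polyC.
Qed.

Lemma depress_poly (F : fieldType) (p : {poly F}) n : n.+1%:R != 0 :> F ->
  p \is monic -> size p = n.+2 ->
  exists c, (p \Po ('X + c%:P))`_n = 0.
Proof.
move=> n0 pm ps; exists (- p`_n / n.+1%:R).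
(* The degree of [p] is [n.+1], so its [n]-th divided derivative is linear and takes at [c] the
   value [p_n + (n+1) c]. *)
rewrite comp_poly_XaddC coef_poly ps leqW// (@horner_coef_wide _ 2); last first.
  apply/leq_sizeP => j j2; rewrite coef_nderivn nth_default ?mul0rn// ps.
  by rewrite -addn2 leq_add2l.
rewrite !big_ord_recr big_ord0 /= !coef_nderivn addn0 addn1 binn binSn.
have -> : p`_n.+1 = 1 by rewrite -(monicP pm) lead_coefE ps.
by rewrite add0r expr0 expr1 mulr1 mulr1n mulrC divfK// subrr.
Qed.

Section AlgClosed.
Variables (V : ogroup) (K : closedFieldType).
Hypothesis V_div : forall (a : V) k, exists b, b *+ k.+1 = a.
Hypothesis K_pchar0 : [pchar K] =i pred0.
Local Notation S := (cser V K).
Implicit Types (G : seq V) (a b c : V) (p q : {poly S}).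

Lemma cs_natr_neq0 n : n.+1%:R != 0 :> S.
Proof.
have e1 : cs_coef 0 (1 : S) = 1 by rewrite /cs_coef cs1E eqxx.
have eM : cs_coef 0 (n.+1%:R : S) = n.+1%:R.
  by rewrite -[in RHS]e1; exact: raddfMn.
apply/eqP => n0; move: eM; rewrite n0 raddf0 => /esym/eqP.
by rewrite ((pcharf0P K).1 K_pchar0).
Qed.

Lemma og_leMn a b k : a <=o b -> a *+ k <=o b *+ k.
Proof.
move=> ab; rewrite -og_subr_ge0 -mulrnBl; elim: k => [|k IH].
  by rewrite mulr0n; exact: og_refl.
by rewrite mulrS; apply: og_addr_ge0; rewrite ?og_subr_ge0.
Qed.

Lemma cs_monoD a b : cs_mono (a + b) 1 = cs_mono a 1 * cs_mono b 1 :> S.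
Proof.
apply: cs_inj => c; rewrite [RHS]conv_monomial mul1r /= /monomial.
by rewrite subr_eq addrC.
Qed.

Lemma cs_monoMn a k : cs_mono (a *+ k) 1 = cs_mono a 1 ^+ k :> S.
Proof. by elim: k => // k IH; rewrite mulrS exprS cs_monoD IH. Qed.

(* The substitution T = x^d U, where d is the slope of the first segment of the
   Newton polygon. *)
Lemma newton_rescale n q : q \is monic -> size q = n.+1 ->
  (exists2 j, (j < n)%N & q`_j != 0) ->
  exists (y : S) Q G,
    [/\ positive G, coefs_in G Q, Q \is monic & size Q = n.+1] /\
    [/\ forall j, q`_j = 0 -> Q`_j = 0,
        exists2 j, (j < n)%N & (pcoef 0 Q)`_j != 0 &
        forall u, root Q u -> root q (y * u)].
Proof.
move=> qm qs [j0 j0n qj0].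
(* The pair [v j] holds the leading exponent and the generators for the [j]-th coefficient, with a
   dummy value when it is zero. *)
have /choice[v vP] j : exists vG, q`_j != 0 -> [/\ positive vG.2,
    q`_j vG.1 != 0 & bounded_by vG.1 vG.2 q`_j].
  have [->|/leading_exponent[v [G ?]]] := eqVneq q`_j 0; last by exists (v, G).
  by exists (0, [::]).
(* The slope [e j] is the leading exponent divided by [n - j]; the form [.-1.+1] keeps the divisor
   positive for every [j] and changes nothing when [j < n]. *)
have /choice[e eP] j : exists e, e *+ (n - j).-1.+1 = (v j).1 by exact: V_div.
have eE j : (j < n)%N -> e j *+ (n - j) = (v j).1.
  by move=> jn; rewrite -eP prednK// subn_gt0.
pose s := [seq j <- iota 0 n | q`_j != 0].
have sP j : (j \in s) = (j < n)%N && (q`_j != 0).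
  by rewrite mem_filter mem_iota add0n andbC.
have [|d /mapP[i] is_ dE dmin] := @og_min _ [seq e j | j <- s].
  by apply: contraTneq (map_f e (_ : j0 \in s)) => [->//|]; rewrite sP j0n.
have {}dmin j : (j < n)%N -> q`_j != 0 -> d <=o e j.
  by move=> jn qj; apply/dmin/map_f; rewrite sP jn.
(* With [d] the least slope, [Q(U)] is [x^(-nd) q(x^d U)]. *)
pose t j : S := cs_mono (- (d *+ (n - j))) 1.
pose Q : {poly S} := \poly_(j < n.+1) (t j * q`_j).
have Qj j : Q`_j = t j * q`_j.
  rewrite coef_poly; case: ltnP => // nj.
  by rewrite [q`_j]nth_default ?mulr0// qs.
have Qn : Q`_n = 1.
  rewrite Qj /t subnn mulr0n oppr0 mul1r -(monicP qm).
  by rewrite lead_coefE qs.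
have Qs : size Q = n.+1.
  by apply: size_poly_eq; rewrite -Qj Qn oner_eq0.
(* The generators for each coefficient, together with its leading exponent after rescaling, which is
   nonnegative by the choice of [d]. *)
pose G := flatten [seq (v j).1 - d *+ (n - j) :: (v j).2 | j <- s].
exists (cs_mono d 1), Q, G; split; split=> //.
- move=> g /flatten_mapP[j]; rewrite sP => /andP[jn qj].
  have [Gj0 _ _] := vP j qj.
  rewrite inE => /orP[/eqP->|/Gj0//]; rewrite og_subr_ge0 -eE//.
  by apply: og_leMn; exact: dmin.
- move=> j; apply/bounded0P => a.
  have [jn|] := ltnP j n; last first.
    rewrite leq_eqVlt => /orP[/eqP<-|nj].
      have [->|a0] := eqVneq a 0; first by move=> _; exact: nspan0.
      by rewrite Qn cs1E (negPf a0) eqxx.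
    by rewrite nth_default ?cs0E ?eqxx// Qs.
  rewrite Qj [X in X != 0]conv_monomial mul1r opprK => qja.
  have qj : q`_j != 0 by apply: contraNneq qja => ->; rewrite cs0E.
  have js : j \in s by rewrite sP jn.
  have [Gj0 _ /(_ _ qja)] := vP j qj.
  rewrite -addrA => Gja.
  rewrite -[a](subrK (- (d *+ (n - j) - (v j).1))) addrC.
  apply: nspanS.
    by apply/flatten_mapP; exists j; rewrite // opprB mem_head.
  rewrite opprK; apply: nspan_sub Gja => g gG.
  by apply/flatten_mapP; exists j; rewrite // inE gG orbT.
- by rewrite monicE lead_coefE Qs Qn.
- by move=> j qj; rewrite Qj qj mulr0.
(* At an index [i] of least slope the rescaled leading exponent is exactly 0. *)
- move: is_; rewrite sP => /andP[in_ qi]; exists i => //.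
  rewrite coef_pcoef Qj [X in X != 0]conv_monomial mul1r sub0r opprK dE eE//.
  by have [] := vP i qi.
move=> u /rootP Qu; apply/rootP.
have -> : q.[cs_mono d 1 * u] = cs_mono d 1 ^+ n * Q.[u].
  rewrite (@horner_coef_wide _ n.+1) ?qs// (@horner_coef_wide _ n.+1) ?Qs//.
  rewrite big_distrr; apply: eq_bigr => j _ /=; rewrite Qj /t.
  have jn : (j <= n)%N by rewrite -ltnS.
  rewrite !mulrA -cs_monoMn -cs_monoD exprMn -cs_monoMn.
  by rewrite -mulrnBr ?leq_subr// subKn// mulrA [q`_j * _]mulrC.
by rewrite Qu mulr0.
Qed.

(** Split off the full power of [X - c] at a root [c]; the cofactor [h] does not vanish at [c], so
    it is coprime to that power. It remains to exclude that [h] is constant. *)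
Lemma split_reduction n (r : {poly K}) : r \is monic -> size r = n.+2 ->
  r`_n = 0 -> (exists2 j, (j < n.+1)%N & r`_j != 0) ->
  exists g h, [/\ g \is monic, h \is monic, coprimep g h & r = g * h] /\
    (1 < size g < size r)%N.
Proof.
move=> rm rs rn [j jn rj].
have /closed_rootP[c rc] : size r != 1%N by rewrite rs.
have [m [h]] := multiplicity_XsubC r c.
rewrite monic_neq0//= => hc rE.
have hm : h \is monic.
  by move: rm; rewrite rE monicMr// monic_exp// monicXsubC.
exists (('X - c%:P) ^+ m), h; split.
  split=> //; last by rewrite mulrC.
    by rewrite monic_exp// monicXsubC.
  by rewrite coprimep_expl// coprimep_sym coprimep_XsubC.
rewrite size_exp_XsubC ltnS lt0n; apply/andP; split.
  apply: contraNneq hc => m0.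
  by move: rc; rewrite {1}rE m0 expr0 mulr1.
have rsE : size r = (size h + m)%N.
  by rewrite {1}rE size_Mmonic ?monic_neq0 ?monic_exp ?monicXsubC//
             size_exp_XsubC addnS.
have h0 : (0 < size h)%N by rewrite size_poly_gt0 monic_neq0.
(* If [h] were constant, [r] would be [(X - c)^(n+1)]. Its subleading coefficient [-(n+1) c]
   vanishes, so [c = 0] in characteristic 0, and all lower coefficients of [r] would be 0. *)
rewrite rsE -[m.+1]add1n ltn_add2r ltn_neqAle h0 andbT; apply/eqP => h1.
have hE : h = 1.
  have /size_poly1P[k k0 hk] : size h == 1%N by rewrite -h1.
  by move: hm; rewrite hk monicE lead_coefC => /eqP->.
have mE : m = n.+1 by apply/eqP; rewrite -(eqn_add2l 1) {1}h1 -rsE rs.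
have rE' : r = \prod_(z <- nseq n.+1 c) ('X - z%:P).
  by rewrite rE hE mul1r mE big_nseq iter_mulr_1.
have c0 : c = 0.
  move: rn; rewrite rE' -[n in _`_n]/(n.+1.-1) -{2}(size_nseq n.+1 c).
  rewrite coefPn_prod_XsubC ?size_nseq// big_nseq iter_addr_0 => /eqP.
  rewrite oppr_eq0 -mulr_natr mulf_eq0 ((pcharf0P K).1 K_pchar0) orbF.
  by move/eqP.
move: rj; rewrite rE hE mul1r mE c0 subr0 coefXn.
by rewrite ltn_eqF// eqxx.
Qed.

(** Induction on the size: the lifted factor [P1] is smaller than [p] and still nonconstant, and its
    roots give roots of [p] after undoing the rescaling and the shift. *)
Lemma cs_root p : p \is monic -> (1 < size p)%N -> exists x, root p x.
Proof.
have [N] := ubnP (size p); elim: N p => // N IH p pN pm.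
case E : (size p) => [|[|n]] // _.
have [c pc0] := depress_poly (cs_natr_neq0 n) pm E.
pose q := p \Po ('X + c%:P).
have s2 : size ('X + c%:P : {poly S}) = 2%N.
  by rewrite size_XaddC.
have qs : size q = n.+2 by rewrite size_comp_poly2// E.
have qm : q \is monic.
  rewrite monicE lead_coef_comp ?s2// (monicP pm) lead_coefXaddC expr1n mulr1.
  by [].
suff [x qx] : exists x, root q x.
  by exists (x + c); move: qx; rewrite !rootE horner_comp !hornerE.
have [[j jn qj]|nex] :=
    pselect (exists2 j, (j < n.+1)%N & q`_j != 0); last first.
  (* Here [q] is a pure power of the variable. *)
  exists 0; rewrite rootE horner_coef0.
  by apply/negPn/negP => q0; apply: nex; exists 0%N.
have [|y [Q [G [[G0 QG Qm Qs] [Q0 Qj Qroot]]]]] := newton_rescale qm qs.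
  by exists j.
have [rs rm] := pcoef0_monic Qm.
have [||g [h [[gm hm co rE] /andP[g1 gr]]]] := split_reduction rm _ _ Qj.
- by rewrite rs Qs.
- by rewrite coef_pcoef Q0// cs0E.
have [P1 [P2 [P1m P1s QE]]] := hensel G0 QG Qm gm hm co rE.
have [||u P1u] := IH P1 _ P1m; rewrite ?P1s//.
  by move: gr; rewrite rs Qs -E => gr; exact: leq_trans gr _.
by exists (y * u); apply: Qroot; rewrite QE rootM P1u.
Qed.

Lemma cs_closed_axiom : GRing.closed_field_axiom S.
Proof.
move=> n P n0; pose r := \poly_(i < n) P i.
have rs : (size (- r) < size ('X^n : {poly S}))%N.
  by rewrite size_polyN size_polyXn ltnS size_poly.
have [||x] := @cs_root ('X^n - r).
- by rewrite monicE lead_coefDl// lead_coefXn.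
- by rewrite size_polyDl// size_polyXn.
rewrite rootE !hornerE subr_eq0 => /eqP xE; exists x.
by rewrite xE horner_poly.
Qed.

Definition cs_closedField : closedFieldType :=
  HB.pack S (Field_isAlgClosed.Build S cs_closed_axiom).

End AlgClosed.

(** * Supports in rational cones *)

Section RationalExponents.
Variables (R : realType) (n : nat) (le : rel 'rV[R]_n).
Hypothesis le_order : continuous_order le.
Hypothesis le_pos : positive_preorder le.
Implicit Types (a b : 'rV[rat]_n) (x y : 'rV[R]_n) (z : 'rV[int]_n).

Local Notation ratv := (@rat_vec R n).
Local Notation intv := (@int_vec R n).
Local Notation int2rat := (map_mx intr : 'rV[int]_n -> 'rV[rat]_n).

Lemma rat_vecD a b : ratv (a + b) = ratv a + ratv b.
Proof. exact: map_mxD. Qed.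

Lemma rat_vecB a b : ratv (a - b) = ratv a - ratv b.
Proof. exact: map_mxB. Qed.

Lemma rat_vec0 : ratv 0 = 0.
Proof. exact: map_mx0. Qed.

Lemma rat_vecMn a k : ratv (a *+ k) = ratv a *+ k.
Proof.
by elim: k => [|k IH]; rewrite ?mulr0n ?rat_vec0// !mulrS rat_vecD IH.
Qed.

Lemma rat_vecZ k a : ratv (k *: a) = ratr k *: ratv a.
Proof. exact: map_mxZ. Qed.

Lemma rat_vec_inj : injective ratv.
Proof. by apply: map_mx_inj; exact: fmorph_inj. Qed.

Lemma rat_vec_int z : ratv (int2rat z) = intv z.
Proof. by apply/rowP => i; rewrite !mxE ratr_int. Qed.

Lemma le_preorder : is_preorder le.
Proof.
have [[us leE] _] := le_order.
have -> : le = lex_preorder us by apply/funext => x; apply/funext => y.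
exact: lex_preorderP.
Qed.

(** The lexicographic description makes real scaling accessible: every dot product is multiplied by
    [l], so the first nonzero one keeps its sign when [l] is positive. *)
Lemma le_scale (l : R) x : 0 <= l -> le 0 x -> le 0 (l *: x).
Proof.
have [[us leE] _] := le_order; rewrite !{}leE => l0.
rewrite /lex_preorder; elim: us => [//|u us IH] /=; rewrite !lexi_cons.
have -> : dotprod 0 u = 0 by apply: big1 => i _; rewrite mxE mul0r.
have -> : dotprod (l *: x) u = l * dotprod x u.
  by rewrite /dotprod big_distrr; apply: eq_bigr => i _; rewrite /= mxE mulrA.
move=> /andP[x0 /implyP xle]; rewrite mulr_ge0//=; apply/implyP => lx.
have [->|ln0] := eqVneq l 0; first by rewrite scale0r.
apply/IH/xle; rewrite -(@pmulr_rle0 _ l)//.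
by rewrite lt_neqAle eq_sym ln0.
Qed.

Definition rat_le a b := le (ratv a) (ratv b).

Lemma rat_le_total : total rat_le.
Proof. by have [tot _ _] := le_preorder => a b; exact: tot. Qed.

Lemma rat_le_trans : transitive rat_le.
Proof. by have [_ tr _] := le_preorder => b a c; exact: tr. Qed.

Lemma rat_le_anti : antisymmetric rat_le.
Proof. by have [_ anti] := le_order => a b /anti/rat_vec_inj. Qed.

Lemma rat_leD a b c : rat_le a b -> rat_le (a + c) (b + c).
Proof.
by have [_ _ add] := le_preorder; rewrite /rat_le !rat_vecD; exact: add.
Qed.

Definition rat_ogroup : ogroup :=
  OGroup rat_le_total rat_le_trans rat_le_anti rat_leD.

Lemma rat_ogroup_div (a : rat_ogroup) k : exists b : rat_ogroup, b *+ k.+1 = a.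
Proof.
exists (k.+1%:R^-1 *: (a : 'rV[rat]_n)).
rewrite -scaler_nat scalerA divff ?scale1r//.
by rewrite pnatr_eq0.
Qed.

Lemma le_add_ge0 x y : le 0 x -> le 0 y -> le 0 (x + y).
Proof.
have [_ tr add] := le_preorder => x0 y0; apply: tr y0 _.
by rewrite -[X in le X _]add0r; exact: add.
Qed.

Lemma cone_ge0 m (u : 'I_m -> 'rV[R]_n) :
  (forall i, le 0 (u i)) -> cone u `<=` nonneg_part le.
Proof.
move=> u0 x [l [l0 ->]]; rewrite /nonneg_part /=.
have [tot _ _] := le_preorder.
elim/big_ind: _ => [|y z|i _]; [by case/orP: (tot 0 0)|exact: le_add_ge0|].
exact: le_scale.
Qed.

(** The points of [(1/k) Z^n] with coordinates at most [N/k] in absolute value; the shift by [N]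
    encodes the integers from [-N] to [N] as ordinals. *)
Definition bounded_grid (k N : nat) : seq 'rV[rat]_n :=
  [seq k%:R^-1 *: int2rat (\row_j ((f j : nat)%:Z - N%:Z))
    | f : {ffun 'I_n -> 'I_N.*2.+1} <- enum {: {ffun 'I_n -> 'I_N.*2.+1}}].

Lemma mem_bounded_grid k N z : (forall j, `|z 0 j| <= N%:Z) ->
  k%:R^-1 *: int2rat z \in bounded_grid k N.
Proof.
move=> zN; apply/mapP.
exists [ffun j => inord `|(z 0 j + N%:Z)%R|%N]; first by rewrite mem_enum.
congr (_ *: int2rat _); apply/rowP => j; rewrite !mxE ffunE inordK.
  by have := zN j; lia.
by have := zN j; lia.
Qed.

Lemma common_denominator (s : seq rat) :
  exists2 k : nat, (0 < k)%N &
    forall x : rat, x \in s -> exists m : int, k%:R * x = m%:~R.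
Proof.
elim: s => [|x s [k k0 ks]]; first by exists 1%N.
exists (`|denq x| * k)%N; first by rewrite muln_gt0 absz_gt0 denq_neq0.
move=> y; rewrite inE natrM => /orP[/eqP->|/ks[m km]].
  exists (k%:Z * numq x).
  rewrite intrM numqE -mulrA mulrC -mulrA; congr (_ * _).
  by congr (_ * _); rewrite -[LHS]/((`|denq x|%N%:Z)%:~R) absz_denq.
by exists (`|denq x|%:Z * m); rewrite intrM -mulrA km.
Qed.

Definition k_integral (k : nat) a := exists z, k%:R *: a = int2rat z.

Lemma k_integralD k a b :
  k_integral k a -> k_integral k b -> k_integral k (a + b).
Proof.
by move=> [z az] [w bw]; exists (z + w); rewrite scalerDr az bw map_mxD.
Qed.

Lemma k_integral0 k : k_integral k 0.
Proof. by exists 0; rewrite scaler0 map_mx0. Qed.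

Lemma k_integralB k a b :
  k_integral k a -> k_integral k b -> k_integral k (a - b).
Proof.
by move=> [z az] [w bw]; exists (z - w); rewrite scalerBr az bw map_mxB.
Qed.

Lemma k_integral_int k z : k_integral k (int2rat z).
Proof.
by exists (z *+ k); apply/rowP => j; rewrite !mxE mulmxnE rmorphMn mulr_natl.
Qed.

Lemma k_integral_all (s : seq 'rV[rat]_n) :
  exists2 k : nat, (0 < k)%N & forall a, a \in s -> k_integral k a.
Proof.
have [k k0 ks] := common_denominator [seq a 0 j | a <- s, j <- enum 'I_n].
exists k => // a as_.
have /choice[f fP] j : exists m : int, k%:R * a 0 j = m%:~R.
  by apply: ks; apply/allpairsP; exists (a, j); rewrite /= mem_enum.
by exists (\row_j f j); apply/rowP => j; rewrite !mxE.
Qed.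

Variable K : fieldType.
Implicit Types xi eta : series K n.

(** Gordan's argument: in [a - gamma], the integer parts of the cone coefficients give a sum of the
    [u i], and the fractional parts give a point of the cone in a bounded part of [(1/k) Z^n]. The
    finitely many possible such points are added to the generators. *)
Lemma cone_series_fg xi : cone_series K le xi -> @fg_supported rat_ogroup K xi.
Proof.
move=> [k [gamma [sigma [k0 [m [u ->]] s0 xiS]]]].
have kR : k%:R != 0 :> R by rewrite pnatr_eq0 -lt0n.
pose U : seq 'rV[rat]_n := [seq int2rat (u i) | i <- enum 'I_m].
(* Bounds the coordinates of [k] times a combination of the [u i] with coefficients between 0 and
   1. *)
pose N := (k * \sum_(i < m) \sum_(j < n) `|u i 0%R j|)%N.
pose L := [seq b <- bounded_grid k N | rat_le 0 b].
exists (int2rat gamma), (U ++ L); split.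
  move=> g; rewrite mem_cat => /orP[/mapP[i _ ->]|]; last first.
    by rewrite mem_filter => /andP[].
  (* Each [u i] lies in the cone, with an indicator function as coefficients. *)
  rewrite /= /rat_le rat_vec0 rat_vec_int; apply: s0.
  exists (fun j => (j == i)%:R); split=> [j|]; first by rewrite ler0n.
  rewrite (bigD1 i)//= eqxx scale1r big1 ?addr0// => j /negPf->.
  by rewrite scale0r.
move=> a xa; have [|[x [l [l0 xE]] xa'] [z _ za]] := xiS (ratv a).
  by exists a.
pose t i := Num.truncn (l i).
pose c : 'rV[rat]_n := \sum_(i < m) int2rat (u i) *+ t i.
have cE : ratv c = \sum_(i < m) (t i)%:R *: intv (u i).
  rewrite /c; elim/big_ind2: _ => [|? ? ? ? <- <-|i _].
  - exact: rat_vec0.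
  - by rewrite rat_vecD.
  - by rewrite rat_vecMn rat_vec_int scaler_nat.
pose b := a - int2rat gamma - c.
have bE : ratv b = \sum_(i < m) (l i - (t i)%:R) *: intv (u i).
  rewrite !rat_vecB rat_vec_int -xa' [_ + x]addrC addrK cE xE -sumrB.
  by apply: eq_bigr => i _; rewrite scalerBl.
have fracP i : 0 <= l i - (t i)%:R <= 1.
  have /andP[tl lt] := truncn_itv (l0 i).
  by rewrite subr_ge0 tl lerBlDl natr1 ltW.
have [w wE] : k_integral k b.
  have ka : k_integral k a.
    exists z; apply: rat_vec_inj; rewrite rat_vecZ -za rat_vec_int ratr_nat.
    by rewrite scalerA divff ?scale1r.
  apply: k_integralB; first exact/k_integralB/k_integral_int.
  rewrite /c; elim/big_ind: _ => [|? ? |i _]; first exact: k_integral0.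
    exact: k_integralD.
  have -> : int2rat (u i) *+ t i = int2rat (u i *+ t i).
    by apply/rowP => j; rewrite mulmxnE !mxE mulmxnE rmorphMn.
  exact: k_integral_int.
have -> : a - int2rat gamma = c + b by rewrite /b subrKC.
apply: nspanD.
  rewrite /c; elim/big_ind: _ => [|? ? |i _]; first exact: nspan0.
    exact: nspanD.
  apply/nspanMn/nspan_gen; rewrite mem_cat; apply/orP; left.
  by apply/mapP; exists i; rewrite // mem_enum.
apply: nspan_gen; rewrite mem_cat mem_filter.
apply/orP; right; apply/andP; split.
  rewrite /rat_le rat_vec0; apply: s0; rewrite bE.
  by exists (fun i => l i - (t i)%:R); split=> // i; case/andP: (fracP i).
have -> : b = k%:R^-1 *: int2rat w.
  by rewrite -wE scalerA mulVf ?scale1r// pnatr_eq0 -lt0n.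
apply: mem_bounded_grid => j.
rewrite -(ler_int R) intr_norm.
have -> : (w 0 j)%:~R =
    k%:R * \sum_(i < m) (l i - (t i)%:R) * (u i 0 j)%:~R :> R.
  have -> : (w 0 j)%:~R = (ratv (k%:R *: b)) 0 j by rewrite wE rat_vec_int mxE.
  rewrite rat_vecZ ratr_nat bE mxE summxE; congr (_ * _).
  by apply: eq_bigr => i _; rewrite !mxE.
rewrite normrM normr_nat /N -[(_ * _)%N%:Z%:~R]/((_ * _)%:R) natrM.
apply: ler_wpM2l; first exact: ler0n.
apply: le_trans (ler_norm_sum _ _ _) _; rewrite natr_sum.
apply: ler_sum => i _; rewrite natr_sum (bigD1 j)//=.
have /andP[f0 f1] := fracP i.
rewrite normrM (ger0_norm f0) -[leLHS]addr0; apply: lerD; last first.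
  by apply: sumr_ge0 => j' _; exact: ler0n.
rewrite -intr_norm -abszE -[leRHS]mul1r.
by apply: ler_wpM2r => //; exact: ler0n.
Qed.

(* Positivity of the order allows the apex g to be rounded down to Z^n. *)
Lemma fg_cone_series xi : @fg_supported rat_ogroup K xi -> cone_series K le xi.
Proof.
move=> [g [G [G0 xiG]]].
pose gamma : 'rV[int]_n := \row_j Num.floor ((g : 'rV[rat]_n) 0 j).
pose d : 'rV[rat]_n := (g : 'rV[rat]_n) - int2rat gamma.
pose s : seq 'rV[rat]_n := d :: G.
have [k k0 ks] := k_integral_all ((g : 'rV[rat]_n) :: s).
have kR : k%:R != 0 :> R by rewrite pnatr_eq0 -lt0n.
have /choice[f fP] a : exists z, a \in s -> k%:R *: a = int2rat z.
  have [as_|] := boolP (a \in s); last by exists 0.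
  by have [|z az] := ks a; [rewrite inE as_ orbT|exists z].
have fE a : a \in s -> intv (f a) = k%:R *: ratv a.
  by move=> /fP fa; rewrite -rat_vec_int -fa rat_vecZ ratr_nat.
(* These integer vectors are [k] times the elements of [s] and span the same cone. *)
pose u (i : 'I_(size s)) := f (nth 0 s i).
have s_ge0 a : a \in s -> le 0 (ratv a).
  rewrite inE => /orP[/eqP->|/G0]; last by rewrite /= /rat_le rat_vec0.
  apply: le_pos => j; rewrite !mxE ler0q subr_ge0.
  exact: floor_le.
have s_cone a : @nspan rat_ogroup s a -> cone (fun i => intv (u i)) (ratv a).
  elim=> [|h b hs _ [l [l0 bE]]].
    exists (fun=> 0); split=> //.
    by rewrite rat_vec0 big1// => i _; rewrite scale0r.
  have hi : (index h s < size s)%N by rewrite index_mem.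
  (* Adding the generator [h] raises the coefficient at its index by [1/k], because [u] is scaled by
     [k]. *)
  exists (fun i => (if i == Ordinal hi then k%:R^-1 else 0) + l i).
  split=> [i|].
    by rewrite addr_ge0//; case: ifP; rewrite // invr_ge0 ler0n.
  under eq_bigr do rewrite scalerDl.
  rewrite big_split /= -bE rat_vecD; congr (_ + _).
  rewrite (bigD1 (Ordinal hi))//= eqxx /u nth_index// fE// scalerA mulVf//.
  by rewrite scale1r big1 ?addr0// => i /negPf->; rewrite scale0r.
exists k, gamma, (cone (fun i => intv (u i))); split=> //.
- by exists (size s), u.
- apply: cone_ge0 => i; rewrite fE ?mem_nth//; apply: le_scale => //.
  exact/s_ge0/mem_nth.
move=> _ [a xa <-]; have Ga := xiG a xa; split.
  exists (ratv (a - int2rat gamma)); last first.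
    by rewrite rat_vecB rat_vec_int subrKC.
  apply: s_cone.
  have -> : a - int2rat gamma = d + (a - (g : 'rV[rat]_n)).
    by rewrite /d [RHS]addrC subrKA.
  apply: (@nspanS rat_ogroup); first by rewrite mem_head.
  by apply: (@nspan_sub rat_ogroup) Ga => h hG; rewrite inE hG orbT.
have [z az] : k_integral k a.
  rewrite -(subrK (g : 'rV[rat]_n) a); apply: k_integralD; last first.
    by apply: ks; rewrite mem_head.
  elim: Ga => [|h b hG _ IH]; first by exists 0; rewrite scaler0 map_mx0.
  by apply: k_integralD => //; apply: ks; rewrite !inE hG !orbT.
exists z => //; rewrite -rat_vec_int -az rat_vecZ ratr_nat scalerA mulVf//.
by rewrite scale1r.
Qed.

End RationalExponents.

(** * Cauchy products of cone series and the closed field they form *)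

(** The first exponent of a contributing pair lies in a finite [cover] and determines the second. *)
Lemma cauchy_defined_fg (R : realType) (K : fieldType) (n : nat)
    (le : rel 'rV[R]_n) (le_order : continuous_order le) (xi eta : series K n) :
  @fg_supported (rat_ogroup le_order) K xi ->
  @fg_supported (rat_ogroup le_order) K eta -> cauchy_defined xi eta.
Proof.
move=> xif etaf; have [g [h [G [G0 xiG etaG]]]] := fg_common xif etaf.
move=> a; pose s := cover g G ((a : rat_ogroup le_order) - h).
apply: (@sub_finite_set _ _ [set` [seq (b, a - b) | b <- s]]); last first.
  exact: finite_seq.
move=> [b c] [/= bca xb ec] /=; apply/mapP; exists b; last first.
  by rewrite -bca addrC addKr.
apply: (cover_bounded G0 xiG etaG) => //.
by rewrite -bca [X in eta X](_ : _ = c)// addrC addKr.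
Qed.

Theorem theorem4p5 (R : realType) (K : closedFieldType)
    (charK0 : [pchar K]%R =i pred0) (n : nat) (n_gt0 : (0 < n)%N)
    (le : rel 'rV[R]_n)
    (le_order : continuous_order le) (le_pos : positive_preorder le) :
  (forall xi eta : series K n, cone_series K le xi -> cone_series K le eta ->
     cauchy_defined xi eta) /\
  alg_closed_field_on (cone_series K le)
    (@series_add K n) (@series_mul K n).
Proof.
split=> [xi eta /(cone_series_fg le_order) xif /(cone_series_fg le_order)|].
  exact: cauchy_defined_fg.
exists (cs_closedField (@rat_ogroup_div _ _ _ le_order) charK0).
(* The bijection forgets the support condition; it respects both operations by computation. *)
exists (fun x : cser (rat_ogroup le_order) K => cs_val x); split=> //.
split=> [x _|x y _ _ xy|xi /(cone_series_fg le_order) xif].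
- exact/fg_cone_series/cs_fg.
- exact: val_inj.
by exists (mkcs xif).
Qed.
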